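(* Let $A$ be a set of actions containing $\tau$ and $(S,\to)$ a labelled transition system with labels from $A$. Then $\simeq_{D_3}\;\subseteq\;\simeq_{D}$ (relations defined in the context).
   Context: $s\xrightarrow{a}s'$ means $(s,a,s')\in\to$; $s\xrightarrow{(a)}s'$ means ''$s\xrightarrow{a}s'$, or ($a=\tau$ and $s=s'$)''; $\twoheadrightarrow$ is the reflexive–transitive closure of $\xrightarrow{\tau}$; $\omega=\{0,1,\dots\}$. For a binary relation $R$ on $S$: (T) if $sRt$ and $s\xrightarrow{a}s'$, then there are $t'',t'$ with $t\twoheadrightarrow t''\xrightarrow{(a)}t'$, $sRt''$ and $s'Rt'$. (D) if $sRt$ and $(s_k)_{k\in\omega}$ is infinite with $s=s_0$, $s_k\xrightarrow{\tau}s_{k+1}$ and $s_kRt$ for all $k$, then there is an infinite $(t_\ell)_{\ell\in\omega}$ with $t=t_0$, $t_\ell\xrightarrow{\tau}t_{\ell+1}$ for all $\ell$, and $s_kRt_\ell$ for all $k,\ell$. (D$_3$) if $sRt$ and $(s_k)_{k\in\omega}$ is infinite with $s=s_0$ and $s_k\xrightarrow{\tau}s_{k+1}$ for all $k$, then there are an infinite $(t_\ell)_{\ell\in\omega}$ and $\sigma:\omega\to\omega$ with $t=t_0$, $t_\ell\xrightarrow{\tau}t_{\ell+1}$ and $s_{\sigma(\ell)}Rt_\ell$ for all $\ell$. $s\simeq_D t$ iff some symmetric $R$ satisfying (T) and (D) has $sRt$; $s\simeq_{D_3}t$ iff some symmetric $R$ satisfying (T) and (D$_3$) has $sRt$. 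*)

(* Defs.v *)
From Stdlib Require Export Relations.

Definition opt_step {A S : Type} (tau : A) (step : S -> A -> S -> Prop)
    (s : S) (a : A) (s' : S) : Prop :=
  step s a s' \/ (a = tau /\ s = s').

Definition tau_step {A S : Type} (tau : A) (step : S -> A -> S -> Prop)
    : relation S :=
  fun s s' => step s tau s'.

Definition tau_steps {A S : Type} (tau : A) (step : S -> A -> S -> Prop)
    : relation S :=
  clos_refl_trans S (tau_step tau step).

Definition cond_T {A S : Type} (tau : A) (step : S -> A -> S -> Prop)
    (R : relation S) : Prop :=
  forall (s t : S) (a : A) (s' : S),
    R s t -> step s a s' ->
    exists t'' t' : S,
      tau_steps tau step t t'' /\ opt_step tau step t'' a t' /\
      R s t'' /\ R s' t'.

Definition cond_D {A S : Type} (tau : A) (step : S -> A -> S -> Prop)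
    (R : relation S) : Prop :=
  forall (s t : S) (sq : nat -> S),
    R s t -> s = sq 0 ->
    (forall k, tau_step tau step (sq k) (sq (k + 1))) ->
    (forall k, R (sq k) t) ->
    exists tq : nat -> S,
      t = tq 0 /\
      (forall l, tau_step tau step (tq l) (tq (l + 1))) /\
      (forall k l, R (sq k) (tq l)).

Definition cond_D3 {A S : Type} (tau : A) (step : S -> A -> S -> Prop)
    (R : relation S) : Prop :=
  forall (s t : S) (sq : nat -> S),
    R s t -> s = sq 0 ->
    (forall k, tau_step tau step (sq k) (sq (k + 1))) ->
    exists (tq : nat -> S) (sigma : nat -> nat),
      t = tq 0 /\
      (forall l, tau_step tau step (tq l) (tq (l + 1))) /\
      (forall l, R (sq (sigma l)) (tq l)).

Definition bisim_D {A S : Type} (tau : A) (step : S -> A -> S -> Prop)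
    : relation S :=
  fun s t => exists R : relation S,
    symmetric S R /\ cond_T tau step R /\ cond_D tau step R /\ R s t.

Definition bisim_D3 {A S : Type} (tau : A) (step : S -> A -> S -> Prop)
    : relation S :=
  fun s t => exists R : relation S,
    symmetric S R /\ cond_T tau step R /\ cond_D3 tau step R /\ R s t.

(* Main.v *)
Require Import Defs.

(** Let [R] witness [s ≃_{D3} t], and let [E] be its reflexive-transitive
    closure.  Conditions (T) and (D3) are both stable under composition of
    relations, so [E] satisfies them and is moreover an equivalence.  For an
    equivalence (D3) implies (D): if all [s_k] are related to [t], they lie in
    one class, and (D3) yields a [tau]-path from [t] inside that class. *)

Lemma clos_refl_trans_symmetric (S : Type) (R : relation S) :
  symmetric S R -> symmetric S (clos_refl_trans S R).
Proof.
  intros HR s t Hst.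
  induction Hst as [s t Hst | s | s u t _ IHsu _ IHut].
  - apply rt_step, HR, Hst.
  - apply rt_refl.
  - exact (rt_trans _ _ _ _ _ IHut IHsu).
Qed.

Section Closure.

Context {A S : Type} {tau : A} {step : S -> A -> S -> Prop}.

(** An answer provided by (T) begins with a whole [tau]-path, so carrying it across a further link
    of a chain requires iterating (T) along that path. *)
Lemma cond_T_tau_steps (R : relation S) (s s' : S) :
  cond_T tau step R -> tau_steps tau step s s' ->
  forall t, R s t -> exists t', tau_steps tau step t t' /\ R s' t'.
Proof.
  intros HT Hs.
  induction Hs as [s s' Hs | s | s u s' _ IHsu _ IHus']; intros t Hst.
  - destruct (HT _ _ _ _ Hst Hs) as (t'' & t' & Ht & [Ht' | [_ <-]] & _ & Hs').
    + exists t'; split; [| exact Hs'].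
      exact (rt_trans _ _ _ _ _ Ht (rt_step _ _ _ _ Ht')).
    + exists t''; split; assumption.
  - exists t; split; [apply rt_refl | exact Hst].
  - destruct (IHsu _ Hst) as (v & Htv & Huv).
    destruct (IHus' _ Huv) as (t' & Hvt' & Hs't').
    exists t'; split; [exact (rt_trans _ _ _ _ _ Htv Hvt') | exact Hs't'].
Qed.

Lemma cond_T_clos_refl_trans (R : relation S) :
  cond_T tau step R -> cond_T tau step (clos_refl_trans S R).
Proof.
  intros HT s t a s' Hst Hs.
  (* Peel links off the right end of the chain: the answer found at [t] becomes the challenge that
     the last link [R t u] transfers to [u]. *)
  apply clos_rt_rtn1 in Hst.
  induction Hst as [| t u Htu _ (t'' & t' & Ht'' & Ht' & Hst'' & Hst')].
  - exists s, s'; repeat split; try apply rt_refl. left; exact Hs.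
  - destruct (cond_T_tau_steps _ _ _ HT Ht'' _ Htu) as (v & Huv & Htv).
    destruct Ht' as [Ht' | [Ha <-]].
    + destruct (HT _ _ _ _ Htv Ht') as (u'' & u' & Hv & Hu' & Htu'' & Htu').
      exists u'', u'; repeat split.
      * exact (rt_trans _ _ _ _ _ Huv Hv).
      * exact Hu'.
      * exact (rt_trans _ _ _ _ _ Hst'' (rt_step _ _ _ _ Htu'')).
      * exact (rt_trans _ _ _ _ _ Hst' (rt_step _ _ _ _ Htu')).
    (* Here [t''] idles on [tau], so [u] idles as well once it has reached [v]. *)
    + exists v, v; repeat split.
      * exact Huv.
      * right; split; [exact Ha | reflexivity].
      * exact (rt_trans _ _ _ _ _ Hst'' (rt_step _ _ _ _ Htv)).
      * exact (rt_trans _ _ _ _ _ Hst' (rt_step _ _ _ _ Htv)).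
Qed.

Lemma cond_D3_clos_refl_trans (R : relation S) :
  cond_D3 tau step R -> cond_D3 tau step (clos_refl_trans S R).
Proof.
  intros HD s t sq Hst Hs Hsq.
  apply clos_rt_rtn1 in Hst.
  induction Hst as [| t u Htu _ (tq & sigma & Ht & Htq & Hst)].
  - exists sq, (fun l => l); repeat split; [exact Hs | exact Hsq |].
    intros l; apply rt_refl.
  - destruct (HD _ _ _ Htu Ht Htq) as (uq & rho & Hu & Huq & Htuq).
    (* The path [tq] answering for [t] served as the challenge to [u], so the index maps compose:
       [sq (sigma (rho l))], [tq (rho l)], [uq l] are linked in turn. *)
    exists uq, (fun l => sigma (rho l)); repeat split; [exact Hu | exact Huq |].
    intros l; exact (rt_trans _ _ _ _ _ (Hst _) (rt_step _ _ _ _ (Htuq l))).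
Qed.

Lemma cond_D3_cond_D (R : relation S) :
  symmetric S R -> transitive S R -> cond_D3 tau step R -> cond_D tau step R.
Proof.
  intros Hsym Htrans HD s t sq Hst Hs Hsq Hsqt.
  destruct (HD _ _ _ Hst Hs Hsq) as (tq & sigma & Ht & Htq & Hstq).
  exists tq; repeat split; [exact Ht | exact Htq |].
  intros k l.
  (* Follow the chain [sq k], [t], [sq (sigma l)], [tq l]; symmetry reverses its second link. *)
  apply Htrans with (sq (sigma l)); [| apply Hstq].
  apply Htrans with t; [apply Hsqt | apply Hsym, Hsqt].
Qed.

End Closure.

Theorem theorem2 (A : Type) (tau : A) (S : Type) (step : S -> A -> S -> Prop) :
  inclusion S (bisim_D3 tau step) (bisim_D tau step).
Proof.
  intros s t (R & Hsym & HT & HD & Hst).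
  exists (clos_refl_trans S R); repeat split.
  - exact (clos_refl_trans_symmetric _ _ Hsym).
  - exact (cond_T_clos_refl_trans _ HT).
  - apply cond_D3_cond_D.
    + exact (clos_refl_trans_symmetric _ _ Hsym).
    + exact (rt_trans S R).
    + exact (cond_D3_clos_refl_trans _ HD).
  - apply rt_step, Hst.
Qed.
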